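(* Let $\kappa>1$ and $v_\kappa:=\frac{\kappa-1}{4}$. Let $J_\kappa$ be the rate function of quenched large deviations of the diffusion $X$ in the drifted Brownian potential $W_\kappa$, and let $J^B_{v_\kappa}(x):=\frac12(x-v_\kappa)^2$ be the rate function of large deviations of the drifted Brownian motion $(B_t+v_\kappa t,\ t\ge0)$. Then $$\forall x>v_\kappa,\qquad J_\kappa(x)<J^B_{v_\kappa}(x).$$
   Context: Let $(W(x),x\in\mathbb{R})$ be a standard two-sided Brownian motion and, for $\kappa\ge0$, $W_\kappa(x):=W(x)-\frac{\kappa}{2}x$. The diffusion $X$ in the random potential $W_\kappa$ is the formal solution of $dX(t)=d\beta(t)-\frac12W_\kappa'(X(t))\,dt$, $X(0)=0$, where $\beta$ is a Brownian motion independent of $W$; precisely, $X$ is a diffusion started at $0$ whose conditional generator given $W_\kappa$ is $\frac12e^{W_\kappa(x)}\frac{\partial}{\partial x}\left(e^{-W_\kappa(x)}\frac{\partial}{\partial x}\right)$. It is known that $X_t/t\to v_\kappa=\frac{(\kappa-1)^+}{4}$ almost surely as $t\to\infty$. It is known (Taleb) that $X$ satisfies a quenched large deviation principle (for $X_t/t$, as $t\to\infty$, for almost every realization of the potential) with deterministic rate function $J_\kappa$ which, for $\kappa>1$ and $x>0$, is given by $$J_\kappa(x)=x\,I_\kappa\left(\frac1x\right),\qquad I_\kappa(u)=\sup_{\lambda\ge0}\left(\Gamma_\kappa(\lambda)-\lambda u\right),\qquad \Gamma_\kappa(\lambda)=\sqrt{2\lambda}\,\frac{K_{\kappa-1}(4\sqrt{2\lambda})}{K_\kappa(4\sqrt{2\lambda})},$$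 with $\Gamma_\kappa(0)=0$, where $K_\nu$ denotes the modified Bessel function (of the second kind) of index $\nu$. *)

(* Defs.v *)
(* MathComp-Analysis, over an arbitrary [R : realType]. *)
From HB Require Import structures.
From mathcomp Require Import all_boot all_order all_algebra.
From mathcomp Require Import all_classical all_reals all_analysis.
Set Implicit Arguments.
Unset Strict Implicit.
Unset Printing Implicit Defensive.
Import Order.TTheory GRing.Theory Num.Theory.
Import numFieldNormedType.Exports.
Local Open Scope classical_set_scope.
Local Open Scope ring_scope.

Definition cosh {R : realType} (s : R) : R := (expR s + expR (- s)) / 2.

(* Modified Bessel function of the second kind of real index [nu]:
     K_nu(z) = \int_0^{+oo} exp(- z cosh s) cosh(nu s) ds,   z > 0.
   Valid for every real [nu], integers included.  For [z > 0] the integrand is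
   integrable; for [z <= 0] the integral diverges and the value is junk. *)
Definition besselK {R : realType} (nu z : R) : R :=
  Rintegral lebesgue_measure `[0, +oo[
    (fun s : R => expR (- (z * cosh s)) * cosh (nu * s)).

(* K is only evaluated at positive arguments: [lambda = 0] is set apart, and
   only [0 <= lambda] is meaningful. *)
Definition Gamma_rate {R : realType} (kappa lambda : R) : R :=
  if lambda == 0 then 0
  else Num.sqrt (2 * lambda) *
       (besselK (kappa - 1) (4 * Num.sqrt (2 * lambda)) /
        besselK kappa (4 * Num.sqrt (2 * lambda))).

(* The supremum is taken in the extended reals, so that its finiteness is not
   presupposed. *)
Definition I_rate {R : realType} (kappa u : R) : \bar R :=
  ereal_sup [set (Gamma_rate kappa lambda - lambda * u)%:E
            | lambda in [set l : R | 0 <= l]].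

(* Taleb's expression, for [1 < kappa] and [0 < x], of the quenched large
   deviation rate function of X_t / t, where X is the diffusion with
   conditional generator
     1/2 e^{W_kappa(x)} d/dx (e^{- W_kappa(x)} d/dx),
   W_kappa(x) = W(x) - kappa x / 2, W a two-sided Brownian motion. *)
Definition J_rate {R : realType} (kappa x : R) : \bar R :=
  (x%:E * I_rate kappa x^-1)%E.

(* Large deviation rate function of (B_t + v t) / t. *)
Definition JB_rate {R : realType} (v x : R) : R := 2^-1 * (x - v) ^+ 2.

(* Main.v *)
Require Import Defs.
From HB Require Import structures.
From mathcomp Require Import all_boot all_order all_algebra.
From mathcomp Require Import all_classical all_reals all_analysis.
From mathcomp Require Import measurable_realfun ring lra.
Import Order.TTheory GRing.Theory Num.Theory.
Import numFieldNormedType.Exports.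
Local Open Scope classical_set_scope.
Local Open Scope ring_scope.

(** The function [Gamma_kappa] is the exponent of the Laplace transform of a
hitting time of the diffusion; the same exponent for the Brownian motion with
drift [v = (kappa - 1) / 4] is [sqrt (v^2 + 2 lambda) - v], and its Legendre
transform gives exactly [(x - v)^2 / 2].  So it suffices to show that
[Gamma_kappa] lies strictly below the Brownian exponent, and to keep this
strictness when passing to the supremum.

Write [a = kappa - 1] and [z = 4 sqrt (2 lambda)].  Then [Gamma_kappa] is
[z K_a(z) / (4 K_(a+1)(z))], and the recurrence
[z (K_(a+1) - K_(a-1)) = 2 a K_a] ([besselK_recurrence]) turns the difference
[v^2 + 2 lambda - (Gamma_kappa + v)^2] into
[2 lambda (K_(a+1) K_(a-1) - K_a^2) / K_(a+1)^2].  The comparison of the two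
exponents is therefore the Turan inequality [K_a^2 < K_(a+1) K_(a-1)], that is,
the strict log-convexity of [K] in its index.

The Turan inequality says that the quadratic polynomial
[Q_z(t) = K_(a+1)(z) - 2 t K_a(z) + t^2 K_(a-1)(z)] has no real root.  It is
the integral of [exp (- z cosh s)] against a factor which does not depend on
[z] and is visibly nonnegative ([cosh_turan_form]).  Hence [Q_z(t)] is positive
and, for each [t], nonincreasing in [z]: its minimum at one value [z'] bounds
[Q_z] from below for all [z <= z'].  This makes the Turan inequality uniform
for bounded [z] ([besselK_turan_uniform]), and hence the gap between the
squares uniform for [lambda] in a compact subset of the positive half-line
([Gamma_rate_gap]).

With [y = sqrt (v^2 + 2 lambda)] one has
[x Gamma - lambda = (x - v)^2 / 2 - (x - y)^2 / 2 - x (y - v - Gamma)].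
When [y] is far from [x] the first square makes the supremand smaller than
[(x - v)^2 / 2] by a definite amount; when [y] is close to [x], [lambda] stays
in a compact subset of the positive half-line, because [x > v], and the uniform
gap does it ([Gamma_rate_legendre_gap]). *)

(** * Hyperbolic functions *)

Section BesselIntegrals.
Context {R : realType}.
Implicit Types (a nu z s t c C : R) (f F : R -> R).
Local Notation mu := (@lebesgue_measure R).
Local Notation halfline := (`[0%R, +oo[%classic : set R).
Local Notation integrableR f := (mu.-integrable halfline (EFin \o f)).
Local Notation besselK_integrand nu z :=
  (fun s => expR (- (z * cosh s)) * cosh (nu * s)).

Definition sinh s : R := (expR s - expR (- s)) / 2.

Lemma cosh_gt0 s : 0 < cosh s.
Proof. by rewrite divr_gt0// addr_gt0// expR_gt0. Qed.

#[local] Instance is_derive_cosh s : is_derive s 1 (@cosh R) (sinh s).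
Proof.
rewrite /cosh /sinh.
apply: trigger_derive; rewrite /GRing.scale/=; ring.
Qed.

#[local] Instance is_derive_sinh s : is_derive s 1 sinh (cosh s).
Proof.
rewrite /cosh /sinh.
apply: trigger_derive; rewrite /GRing.scale/=; ring.
Qed.

Lemma continuous_cosh : continuous (@cosh R).
Proof.
move=> s; apply/differentiable_continuous/derivable1_diffP.
by have [] := is_derive_cosh s.
Qed.

(** * Improper integrals of exponentially decaying functions *)

Lemma is_derive_expN c s :
  is_derive s 1 (fun u => - (c * expR (- u))) (c * expR (- s)).
Proof.
apply: trigger_derive; rewrite /GRing.scale/=; ring.
Qed.

Lemma cvgy_squeeze0 C F :
  (forall s, 0 <= s -> `|F s| <= C * expR (- s)) ->
  F s @[s --> +oo] --> 0.
Proof.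
move=> FC; have cvC : C * expR (- s) @[s --> +oo] --> 0.
  have := cvgM (cvg_cst C) (@cvgr_expR R); rewrite mulr0; exact.
apply/norm_cvg0P.
apply: (@squeeze_cvgr _ _ _ _ (fun=> 0) (fun s => C * expR (- s))) => //.
- near=> s; rewrite normr_ge0/=; apply: FC.
  by near: s; apply: nbhs_pinfty_ge; rewrite num_real.
- exact: cvg_cst.
Unshelve. all: by end_near. Qed.

Lemma Rintegral_derivative_ge0 f F :
  continuous f -> (forall s, is_derive s 1 F (f s)) ->
  (forall s, 0 <= s -> 0 <= f s) -> F s @[s --> +oo] --> 0 ->
  (\int[mu]_(s in halfline) (f s)%:E)%E = (- F 0)%:E.
Proof.
move=> cf dF f0 Fy.
rewrite (@ge0_continuous_FTC2y _ f F 0 0) ?sub0e//.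
- exact: continuous_subspaceT.
- apply: cvg_at_right_filter.
  apply/differentiable_continuous/derivable1_diffP.
  by have [] := dF 0.
- by move=> s _; rewrite derive1E; have [_ ->] := dF s.
Qed.

Lemma integrable_expRN c : integrableR (fun s => c * expR (- s)).
Proof.
have cE : continuous (fun s : R => expR (- s)).
  move=> s; apply: continuous_comp; first exact: opp_continuous.
  exact: continuous_expR.
suff : integrableR (fun s => expR (- s)) by apply: integrableZl.
apply/integrableP; split.
  apply/measurable_EFinP; apply: measurable_funTS.
  exact: continuous_measurable_fun.
have dE s : is_derive s 1 (fun u : R => - (1 * expR (- u))) (expR (- s)).
  by have := is_derive_expN 1 s; rewrite mul1r.
under eq_integral do rewrite /= ger0_norm ?expR_ge0//.
rewrite (Rintegral_derivative_ge0 _ _ _ dE) ?ltry//.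
- apply: (cvgy_squeeze0 1) => s _.
  by rewrite normrN mul1r ger0_norm ?expR_ge0.
Qed.

Lemma integrable_expRN_bound C f : continuous f ->
  (forall s, 0 <= s -> `|f s| <= C * expR (- s)) -> integrableR f.
Proof.
move=> cf fC; apply: le_integrable (integrable_expRN C) => //.
  apply/measurable_EFinP; apply: measurable_funTS.
  exact: continuous_measurable_fun.
move=> s; rewrite /= in_itv/= andbT => s0.
by rewrite lee_fin (le_trans (fC s s0))// ler_norm.
Qed.

(** The fundamental theorem of calculus on the half-line, for an integrand of
either sign: adding [C exp (- s)], whose integral is [C], makes the integrand
nonnegative and reduces to the nonnegative case. *)
Lemma Rintegral_derivative C f F :
  continuous f -> (forall s, is_derive s 1 F (f s)) ->
  (forall s, 0 <= s -> `|f s| <= C * expR (- s)) ->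
  (forall s, 0 <= s -> `|F s| <= C * expR (- s)) ->
  \int[mu]_(s in halfline) f s = - F 0.
Proof.
move=> cf dF fC FC.
have intf := integrable_expRN_bound C f cf fC.
have intE := integrable_expRN C.
have cE : continuous (fun s : R => C * expR (- s)).
  move=> s; apply: (@continuousM R R (fun=> C) (fun s => expR (- s))).
    exact: cst_continuous.
  apply: continuous_comp; first exact: opp_continuous.
  exact: continuous_expR.
have C0 : 0 <= C.
  by have := le_trans (normr_ge0 _) (fC 0 (lexx _)); rewrite oppr0 expR0 mulr1.
have EN0 : - (C * expR (- s)) @[s --> +oo] --> 0.
  apply: (cvgy_squeeze0 C) => s s0.
  by rewrite normrN ger0_norm// mulr_ge0 ?expR_ge0.
have IE : \int[mu]_(s in halfline) (C * expR (- s)) = C.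
  rewrite /Rintegral (Rintegral_derivative_ge0 _ _ cE (is_derive_expN C))//=.
  - by rewrite opprK oppr0 expR0 mulr1.
  - by move=> s s0; rewrite mulr_ge0 ?expR_ge0.
have dG s : is_derive s 1 (fun u => F u - C * expR (- u))
                          (f s + C * expR (- s)).
  by apply: is_deriveD; exact: is_derive_expN.
have cG : continuous (fun s => f s + C * expR (- s)).
  by move=> s; apply: (@continuousD _ _ _ f); [exact: cf | exact: cE].
have : \int[mu]_(s in halfline) (f s + C * expR (- s)) = - F 0 + C.
  rewrite /Rintegral (Rintegral_derivative_ge0 _ _ cG dG)/=.
  - by rewrite oppr0 expR0 mulr1 opprB addrC.
  - move=> s s0; have := fC s s0; rewrite ler_norml => /andP[+ _]; lra.
  - rewrite -[X in _ --> X]addr0; apply: cvgD EN0; exact: cvgy_squeeze0 FC.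
by rewrite RintegralD// IE => /addIr.
Qed.

(** An integral of a nonnegative function vanishes only if the function is zero
almost everywhere, which positivity on a half-line of infinite measure
excludes. *)
Lemma Rintegral_gt0 c f : continuous f -> integrableR f ->
  (forall s, 0 <= s -> 0 <= f s) -> (forall s, c < s -> 0 < f s) ->
  0 < \int[mu]_(s in halfline) f s.
Proof.
move=> cf intf f0 fc.
have mf : measurable_fun halfline (EFin \o f).
  by apply/measurable_EFinP; apply: measurable_funTS;
    exact: continuous_measurable_fun.
rewrite lt0r Rintegral_ge0 ?andbT; last first.
  by move=> s; rewrite /= in_itv/= andbT => /f0.
apply/eqP => I0.
have : (\int[mu]_(s in halfline) `|(EFin \o f) s| = 0)%E.
  transitivity (\int[mu]_(s in halfline) (f s)%:E)%E.
    apply: eq_integral => s; rewrite inE/= in_itv/= andbT => s0.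
    by rewrite ger0_norm ?f0.
  by rewrite -(fineK (integrable_fin_num _ intf))//; congr (_%:E).
move=> /(ae_eq_integral_abs mu _ mf) => /(_ (measurable_itv _)) [N [mN N0 sub]].
have : (mu `](Num.max 0%R c), +oo[%classic <= mu N)%E.
  apply: le_measure; rewrite ?inE//=.
  apply: subset_trans sub => s.
  rewrite /= in_itv/= andbT gt_max => /andP[s0 cs].
  move=> /(_ _); rewrite in_itv/= andbT (ltW s0) => /(_ isT) [] fs0.
  by have := fc s cs; rewrite fs0 ltxx.
by rewrite N0 lebesgue_measure_itv/= ltry.
Qed.

(** * The integral defining [besselK] *)

Lemma continuous_besselK_integrand nu z : continuous (besselK_integrand nu z).
Proof.
move=> s; apply: (@continuousM R R (fun s => expR (- (z * cosh s)))
                     (fun s => cosh (nu * s))).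
  apply: continuous_comp; last exact: continuous_expR.
  apply: (@continuousN R R _ (fun s => z * cosh s)).
  apply: (@continuousM R R (fun=> z)); first exact: cst_continuous.
  exact: continuous_cosh.
apply: continuous_comp; last exact: continuous_cosh.
by apply: (@continuousM R R (fun=> nu)); [exact: cst_continuous|].
Qed.

Lemma cosh_le_expR nu s : 0 <= s -> cosh (nu * s) <= expR (`|nu| * s).
Proof.
move=> s0; rewrite /cosh ler_pdivrMr// mulr_natr mulr2n lerD// ler_expR.
  by rewrite ler_wpM2r// ler_norm.
by rewrite -mulNr ler_wpM2r// -normrN ler_norm.
Qed.

(** The double exponential decay beats [cosh (nu s)]: the convex function
[z exp s / 2] lies above its tangent of slope [|nu| + 1], at the point [L]. *)
Lemma besselK_integrand_bound nu z : 0 < z ->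
  exists C, forall s, 0 <= s -> besselK_integrand nu z s <= C * expR (- s).
Proof.
move=> z0; pose N := `|nu| + 1; have N0 : 0 < N by rewrite ltr_wpDl.
pose L := ln (2 * N / z).
have LE : z * expR L = 2 * N.
  by rewrite lnK ?posrE ?divr_gt0 ?mulr_gt0// mulrC divfK// gt_eqF.
exists (expR (- (N * (1 - L)))) => s s0.
have le_cosh : N * (1 + (s - L)) <= z * cosh s.
  have h : expR L * (1 + (s - L)) <= expR s.
    rewrite -[leRHS](_ : expR L * expR (s - L) = _) ?ler_pM2l ?expR_gt0//.
      exact: expR_ge1Dx.
    by rewrite -expRD addrC subrK.
  have : z * (expR L * (1 + (s - L))) <= z * expR s by rewrite ler_pM2l.
  rewrite mulrA LE => {}h.
  have : 0 < z * expR (- s) by rewrite mulr_gt0 ?expR_gt0.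
  rewrite /cosh; lra.
have -> : expR (- (N * (1 - L))) * expR (- s) =
          expR (- (N * (1 + (s - L)))) * expR (`|nu| * s).
  by rewrite -!expRD; congr expR; rewrite /N; ring.
apply: ler_pM; [exact: expR_ge0|exact/ltW/cosh_gt0| |exact: cosh_le_expR].
by rewrite ler_expR lerN2.
Qed.

Lemma besselK_integrand_ge0 nu z s : 0 <= besselK_integrand nu z s.
Proof. by rewrite mulr_ge0 ?expR_ge0 ?(ltW (cosh_gt0 _)). Qed.

Lemma integrable_besselK nu z : 0 < z -> integrableR (besselK_integrand nu z).
Proof.
move=> z0; have [C bC] := besselK_integrand_bound nu z z0.
apply: (integrable_expRN_bound C); first exact: continuous_besselK_integrand.
move=> s s0; rewrite ger0_norm ?bC//; exact: besselK_integrand_ge0.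
Qed.

Lemma besselK_gt0 nu z : 0 < z -> 0 < besselK nu z.
Proof.
move=> z0; apply: (Rintegral_gt0 0).
- exact: continuous_besselK_integrand.
- exact: integrable_besselK.
- by move=> s _; exact: besselK_integrand_ge0.
- by move=> s _; rewrite mulr_gt0 ?expR_gt0 ?cosh_gt0.
Qed.

Lemma besselK_antitone nu z z' : 0 < z -> z <= z' ->
  besselK nu z' <= besselK nu z.
Proof.
move=> z0 zz'; have z'0 := lt_le_trans z0 zz'.
apply: le_Rintegral => //; try exact: integrable_besselK.
move=> s _; rewrite ler_wpM2r ?(ltW (cosh_gt0 _))// ler_expR lerN2.
by rewrite ler_wpM2r ?(ltW (cosh_gt0 _)).
Qed.

(** * The Turan inequality *)

(** The polynomial in [t] on the left is the integrand of [turan_form] without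
its exponential weight; since it is a sum of squares, the sign and the
monotonicity in [z] of the integral can be read off pointwise. *)
Lemma cosh_turan_form a t s :
  cosh ((a + 1) * s) - 2 * t * cosh (a * s) + t ^+ 2 * cosh ((a - 1) * s) =
  (expR ((a - 1) * s) * (expR s - t) ^+ 2 +
   expR (- ((a - 1) * s)) * (expR (- s) - t) ^+ 2) / 2.
Proof.
have E1 : expR ((a + 1) * s) = expR ((a - 1) * s) * expR s ^+ 2.
  by rewrite expr2 -!expRD; congr expR; ring.
have E2 : expR (- ((a + 1) * s)) = expR (- ((a - 1) * s)) * expR (- s) ^+ 2.
  by rewrite expr2 -!expRD; congr expR; ring.
have E3 : expR (a * s) = expR ((a - 1) * s) * expR s.
  by rewrite -!expRD; congr expR; ring.
have E4 : expR (- (a * s)) = expR (- ((a - 1) * s)) * expR (- s).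
  by rewrite -!expRD; congr expR; ring.
by rewrite /cosh E1 E2 E3 E4; field.
Qed.

Lemma cosh_turan_form_ge0 a t s :
  0 <= cosh ((a + 1) * s) - 2 * t * cosh (a * s) + t ^+ 2 * cosh ((a - 1) * s).
Proof.
by rewrite cosh_turan_form divr_ge0// addr_ge0// mulr_ge0 ?expR_ge0 ?sqr_ge0.
Qed.

Lemma cosh_turan_form_gt0 a t s : t < s ->
  0 < cosh ((a + 1) * s) - 2 * t * cosh (a * s) + t ^+ 2 * cosh ((a - 1) * s).
Proof.
move=> ts; rewrite cosh_turan_form divr_gt0//; apply: ltr_wpDr.
  by rewrite mulr_ge0 ?expR_ge0 ?sqr_ge0.
rewrite mulr_gt0 ?expR_gt0// exprn_gt0// subr_gt0 (lt_le_trans ts)//.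
rewrite (le_trans _ (expR_ge1Dx s))//.
by rewrite lerDr.
Qed.

Definition turan_integrand a t z s :=
  expR (- (z * cosh s)) *
  (cosh ((a + 1) * s) - 2 * t * cosh (a * s) + t ^+ 2 * cosh ((a - 1) * s)).

(** As a quadratic polynomial in [t] this has discriminant
[4 (K_a^2 - K_(a+1) K_(a-1))], so that the Turan inequality says that it is
positive for all [t]. *)
Definition turan_form a t z :=
  besselK (a + 1) z - 2 * t * besselK a z + t ^+ 2 * besselK (a - 1) z.

Lemma turan_integrandE a t z : turan_integrand a t z = (fun s =>
  besselK_integrand (a + 1) z s + (- (2 * t)) * besselK_integrand a z s
  + t ^+ 2 * besselK_integrand (a - 1) z s).
Proof. by apply/funext => s; rewrite /turan_integrand; ring. Qed.

Lemma continuous_lin3 f1 f2 f3 p q :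
  continuous f1 -> continuous f2 -> continuous f3 ->
  continuous (fun s => f1 s + p * f2 s + q * f3 s).
Proof.
have cM r f : continuous f -> continuous (fun s => r * f s).
  move=> cf s; apply: (@continuousM R R (fun=> r)); last exact: cf.
  exact: cst_continuous.
move=> c1 c2 c3 s.
apply: (@continuousD _ _ _ (fun s => f1 s + p * f2 s)); last exact: cM.
by apply: (@continuousD _ _ _ f1); [exact: c1|exact: cM].
Qed.

Lemma integrable_lin3 f1 f2 f3 p q :
  integrableR f1 -> integrableR f2 -> integrableR f3 ->
  integrableR (fun s => f1 s + p * f2 s + q * f3 s) /\
  \int[mu]_(s in halfline) (f1 s + p * f2 s + q * f3 s) =
  \int[mu]_(s in halfline) f1 s + p * \int[mu]_(s in halfline) f2 s
  + q * \int[mu]_(s in halfline) f3 s.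
Proof.
move=> i1 i2 i3.
have i2' : integrableR (fun s => p * f2 s) by move: i2; apply: integrableZl.
have i3' : integrableR (fun s => q * f3 s) by move: i3; apply: integrableZl.
have i12 : integrableR (fun s => f1 s + p * f2 s).
  by apply: (integrableD _ i1 i2').
split; first by apply: (integrableD _ i12 i3').
by rewrite RintegralD// RintegralD// RintegralZl// RintegralZl.
Qed.

Lemma turan_form_integral a t z : 0 < z ->
  integrableR (turan_integrand a t z) /\
  turan_form a t z = \int[mu]_(s in halfline) turan_integrand a t z s.
Proof.
move=> z0; have i nu := integrable_besselK nu z z0.
have [iT ET] := integrable_lin3 _ _ _ (- (2 * t)) (t ^+ 2)
  (i (a + 1)) (i a) (i (a - 1)).
rewrite turan_integrandE.
by split=> //; rewrite ET /turan_form /besselK mulNr.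
Qed.

Lemma turan_form_gt0 a t z : 0 < z -> 0 < turan_form a t z.
Proof.
move=> z0; have [iT ->] := turan_form_integral a t z z0.
apply: (Rintegral_gt0 t) => //.
- rewrite turan_integrandE.
  have c nu := continuous_besselK_integrand nu z.
  exact: continuous_lin3 (c _) (c _) (c _).
- by move=> s _; rewrite mulr_ge0 ?expR_ge0 ?cosh_turan_form_ge0.
- by move=> s ts; rewrite mulr_gt0 ?expR_gt0 ?cosh_turan_form_gt0.
Qed.

Lemma turan_form_antitone a t z z' : 0 < z -> z <= z' ->
  turan_form a t z' <= turan_form a t z.
Proof.
move=> z0 zz'; have z'0 := lt_le_trans z0 zz'.
have [i ->] := turan_form_integral a t z z0.
have [i' ->] := turan_form_integral a t z' z'0.
apply: le_Rintegral => // s _.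
rewrite ler_wpM2r ?cosh_turan_form_ge0// ler_expR lerN2.
by rewrite ler_wpM2r ?(ltW (cosh_gt0 _)).
Qed.

(** The bound at [z'] serves for all smaller [z]: [turan_form] is at least its
minimum over [t] at [z'], and the coefficient [K_(a-1)], by which the minimum
has to be multiplied to get the Turan determinant, also decreases in [z]. *)
Lemma besselK_turan_uniform a z' : 0 < z' -> exists2 q, 0 < q &
  forall z, 0 < z -> z <= z' ->
    q <= besselK (a + 1) z * besselK (a - 1) z - besselK a z ^+ 2.
Proof.
move=> z'0; pose K nu := besselK nu z'.
have K0 nu : 0 < K nu by exact: besselK_gt0.
have Kn0 : K (a - 1) != 0 by rewrite gt_eqF.
pose D := K (a + 1) * K (a - 1) - K a ^+ 2.
(* completing the square in [t] *)
have minK t :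
    turan_form a t z' = D / K (a - 1) + K (a - 1) * (t - K a / K (a - 1)) ^+ 2.
  have -> : turan_form a t z' =
      K (a + 1) - 2 * t * K a + t ^+ 2 * K (a - 1) by [].
  by rewrite /D; field.
have D0 : 0 < D / K (a - 1).
  have := turan_form_gt0 a (K a / K (a - 1)) z' z'0.
  by rewrite minK subrr expr0n mulr0 addr0.
exists D; first by rewrite -(pmulr_lgt0 _ (_ : 0 < (K (a - 1))^-1)) ?invr_gt0.
move=> z z0 zz'; pose k nu := besselK nu z.
have k0 nu : 0 < k nu by exact: besselK_gt0.
have kn0 : k (a - 1) != 0 by rewrite gt_eqF.
rewrite -[leLHS](divfK Kn0) mulrC.
have -> : besselK (a + 1) z * besselK (a - 1) z - besselK a z ^+ 2 =
    k (a - 1) * turan_form a (k a / k (a - 1)) z.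
  have -> t : turan_form a t z =
      k (a + 1) - 2 * t * k a + t ^+ 2 * k (a - 1) by [].
  by rewrite -/(k _) -/(k _) -/(k _); field.
apply: ler_pM; [exact: ltW|exact: ltW|exact: besselK_antitone|].
apply: le_trans (turan_form_antitone _ _ _ _ z0 zz').
by rewrite minK lerDl mulr_ge0 ?sqr_ge0 ?ltW.
Qed.


(** * The recurrence in the index *)

Lemma sinhM_cosh a s :
  sinh s * sinh (a * s) = (cosh ((a + 1) * s) - cosh ((a - 1) * s)) / 2.
Proof.
rewrite /sinh /cosh.
have -> : (a + 1) * s = a * s + s by ring.
have -> : (a - 1) * s = a * s - s by ring.
by rewrite !opprD opprK !expRD; field.
Qed.

Lemma norm_sinh_le s : `|sinh s| <= cosh s.
Proof.
have := expR_gt0 s; have := expR_gt0 (- s).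
rewrite /sinh /cosh ler_norml => h1 h2; apply/andP; split; lra.
Qed.

(** Integration by parts: the integrand of
[K_(a+1) - (2 a / z) K_a - K_(a-1)] is the derivative of
[- (2 / z) exp (- z cosh s) sinh (a s)], which vanishes at both ends. *)
Lemma besselK_recurrence a z : 0 < z ->
  z * (besselK (a + 1) z - besselK (a - 1) z) = 2 * a * besselK a z.
Proof.
move=> z0; have i nu := integrable_besselK nu z z0.
have c nu := continuous_besselK_integrand nu z.
pose b nu : R -> R := besselK_integrand nu z.
have b0 nu s : 0 <= b nu s by exact: besselK_integrand_ge0.
pose f s := b (a + 1) s + (- (2 * a / z)) * b a s + (- 1) * b (a - 1) s.
pose F s := (- (2 / z)) * (expR (- (z * cosh s)) * sinh (a * s)).
have dF s : is_derive s 1 F (f s).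
  rewrite /F; apply: trigger_derive; rewrite /GRing.scale/=.
  have -> : f s = expR (- (z * cosh s)) *
      (2 * (sinh s * sinh (a * s)) - 2 * a / z * cosh (a * s)).
    by rewrite sinhM_cosh /f /b; field; rewrite gt_eqF.
  by field; rewrite gt_eqF.
have cf : continuous f by exact: continuous_lin3 (c _) (c _) (c _).
have [Cp bp] := besselK_integrand_bound (a + 1) z z0.
have [C bC] := besselK_integrand_bound a z z0.
have [Cm bm] := besselK_integrand_bound (a - 1) z z0.
(* one constant that dominates both the primitive and its derivative *)
pose M := Cp + (2 * `|a| / z + 2 / z) * C + Cm.
have zV0 : 0 < z^-1 by rewrite invr_gt0.
have C0 C' nu : (forall s, 0 <= s -> b nu s <= C' * expR (- s)) -> 0 <= C'.
  by move=> /(_ 0 (lexx _)); rewrite oppr0 expR0 mulr1; apply: le_trans.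
have Cp0 := C0 _ _ bp; have Cm0 := C0 _ _ bm; have {}C0 := C0 _ _ bC.
have fM s : 0 <= s -> `|f s| <= M * expR (- s).
  move=> s0; rewrite /f (le_trans (ler_normD _ _))//.
  rewrite (le_trans (lerD (ler_normD _ _) (lexx _)))//.
  rewrite mulN1r normrN (normrM (- (2 * a / z))) normrN.
  rewrite (normrM (2 * a)) (normrM 2) normfV.
  rewrite !(ger0_norm (b0 _ _)) (gtr0_norm z0) (ger0_norm (_ : 0 <= 2))//.
  have h := bC s s0.
  have h' : 2 * `|a| / z * b a s <= 2 * `|a| / z * (C * expR (- s)).
    by rewrite ler_wpM2l ?mulr_ge0// ltW.
  have h'' : 0 <= 2 / z * (C * expR (- s)).
    by rewrite mulr_ge0 ?mulr_ge0 ?expR_ge0// ltW.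
  have := bp s s0; have := bm s s0; rewrite /M -/(b _) -/(b _).
  move: h' h''; rewrite /b; lra.
have FM s : 0 <= s -> `|F s| <= M * expR (- s).
  move=> s0; rewrite /F (normrM (- (2 / z))) normrN (normrM 2) normfV.
  rewrite (normrM (expR _)).
  rewrite (gtr0_norm z0) (ger0_norm (_ : 0 <= 2))// (ger0_norm (expR_ge0 _)).
  have h : expR (- (z * cosh s)) * `|sinh (a * s)| <= C * expR (- s).
    by apply: le_trans (bC s s0); rewrite ler_wpM2l ?expR_ge0 ?norm_sinh_le.
  have h' : 2 / z * (expR (- (z * cosh s)) * `|sinh (a * s)|) <=
            2 / z * (C * expR (- s)).
    by rewrite ler_wpM2l ?mulr_ge0// ltW.
  have h1 : 0 <= Cp * expR (- s) by rewrite mulr_ge0 ?expR_ge0.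
  have h2 : 0 <= Cm * expR (- s) by rewrite mulr_ge0 ?expR_ge0.
  have h3 : 0 <= 2 * `|a| / z * (C * expR (- s)).
    by rewrite !mulr_ge0 ?expR_ge0// ltW.
  rewrite /M; lra.
have := Rintegral_derivative M f F cf dF fM FM.
rewrite [F 0](_ : _ = 0) ?oppr0; last first.
  by rewrite /F /sinh mulr0 oppr0 subrr mul0r !mulr0.
have [_ ->] := integrable_lin3 _ _ _ (- (2 * a / z)) (- 1)
  (i (a + 1)) (i a) (i (a - 1)).
rewrite -/(besselK _ _) -/(besselK _ _) -/(besselK _ _) => h.
have -> : besselK (a + 1) z - besselK (a - 1) z = 2 * a / z * besselK a z.
  by move: h; lra.
by field; rewrite gt_eqF.
Qed.
End BesselIntegrals.

(** * Comparison of the exponents and of their Legendre transforms *)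

(** By the recurrence the difference of the two sides, without [e], is
[2 l (K_kappa K_(kappa - 2) - K_(kappa - 1)^2) / K_kappa^2], taken at
[4 sqrt (2 l)].  The Turan determinant is bounded below up to [l2], and the
remaining factors are smallest at [l1]. *)
Lemma Gamma_rate_gap (R : realType) (kappa l1 l2 : R) : 0 < l1 -> l1 <= l2 ->
  exists2 e, 0 < e & forall l, l1 <= l -> l <= l2 ->
    (Gamma_rate kappa l + (kappa - 1) / 4) ^+ 2 + e <=
    ((kappa - 1) / 4) ^+ 2 + 2 * l.
Proof.
move=> l10 l12; pose zeta (l : R) := 4 * Num.sqrt (2 * l).
have zeta0 l : 0 < l -> 0 < zeta l.
  by move=> l0; rewrite /zeta mulr_gt0// sqrtr_gt0 mulr_gt0.
have zetaE l : 0 < l -> zeta l ^+ 2 = 32 * l.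
  move=> l0; rewrite /zeta exprMn sqr_sqrtr ?mulr_ge0 ?ltW//; ring.
have le_zeta l l' : 0 < l -> l <= l' -> zeta l <= zeta l'.
  move=> l0 ll'; rewrite /zeta ler_pM2l// ler_sqrt ?ler_pM2l//.
  by rewrite mulr_ge0// ltW// (lt_le_trans l0).
have l20 := lt_le_trans l10 l12.
have [q q0 turan] := besselK_turan_uniform (kappa - 1) (zeta l2) (zeta0 _ l20).
have c10 := besselK_gt0 kappa _ (zeta0 _ l10).
exists (2 * l1 * (q / besselK kappa (zeta l1) ^+ 2)).
  by rewrite !mulr_gt0// invr_gt0 exprn_gt0.
move=> l ll1 ll2; have l0 := lt_le_trans l10 ll1.
have z0 := zeta0 _ l0; have z2 := zetaE _ l0.
have := turan (zeta l) z0 (le_zeta _ _ l0 ll2).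
have := besselK_recurrence (kappa - 1) _ z0.
have c0 := besselK_gt0 kappa _ z0.
have cc1 := besselK_antitone kappa _ _ (zeta0 _ l10) (le_zeta _ _ l10 ll1).
rewrite /Gamma_rate gt_eqF// -/(zeta l) subrK.
have -> : Num.sqrt (2 * l) = zeta l / 4 by rewrite /zeta; field.
move: z0 z2 c0 c10 cc1; set z := zeta l.
move: (besselK kappa z) (besselK kappa (zeta l1)) (besselK (kappa - 1) z)
  (besselK (kappa - 1 - 1) z).
move=> c c1 b d z0 z2 c0 c10 cc1 rec tur.
have -> : ((kappa - 1) / 4) ^+ 2 + 2 * l =
    (z / 4 * (b / c) + (kappa - 1) / 4) ^+ 2 +
    2 * l * ((c * d - b ^+ 2) / c ^+ 2).
  have -> : 2 * l = z ^+ 2 / 16 by rewrite z2; field.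
  (* eliminating [K_(kappa - 2)] by the recurrence makes this an identity *)
  have -> : d = c - 2 * (kappa - 1) * b / z.
    by rewrite -rec; field; rewrite gt_eqF.
  by field; rewrite !gt_eqF.
rewrite lerD2l; apply: ler_pM.
- by rewrite mulr_ge0// ltW.
- by rewrite divr_ge0 ?sqr_ge0// ltW.
- by rewrite ler_pM2l.
- apply: ler_pM => //; [exact: ltW|by rewrite invr_ge0 sqr_ge0|].
  by rewrite lef_pV2 ?posrE ?exprn_gt0// ler_pXn2r// nnegrE ltW.
Qed.

Lemma Gamma_rate_le (R : realType) (kappa l : R) : 0 <= l ->
  (Gamma_rate kappa l + (kappa - 1) / 4) ^+ 2 <= ((kappa - 1) / 4) ^+ 2 + 2 * l.
Proof.
rewrite le_eqVlt => /predU1P[<-|l0].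
  by rewrite /Gamma_rate eqxx add0r mulr0 addr0.
have [e e0 /(_ l (lexx _) (lexx _))] := Gamma_rate_gap R kappa l l l0 (lexx _).
by apply: le_trans; rewrite lerDl ltW.
Qed.

(** The margin [eta] does not depend on [l], so that the inequality stays strict
for the supremum over [l]. *)
Lemma Gamma_rate_legendre_gap (R : realType) (kappa x : R) :
  let v := (kappa - 1) / 4 in 0 <= v -> v < x ->
  exists2 eta, 0 < eta & forall l, 0 <= l ->
    x * Gamma_rate kappa l - l <= JB_rate v x - eta.
Proof.
move=> v v0 vx; have x0 := le_lt_trans v0 vx.
(* [l1 <= l <= l2] means that [y := sqrt (v ^+ 2 + 2 * l)] is within [d] of [x];
   the value of [d] keeps [x - d] above [v], hence [l1] above 0. *)
pose d := (x - v) / 2; have d0 : 0 < d by rewrite /d; lra.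
pose l1 := ((x - d) ^+ 2 - v ^+ 2) / 2; pose l2 := ((x + d) ^+ 2 - v ^+ 2) / 2.
have xd : x = v + 2 * d by rewrite /d; field.
have l10 : 0 < l1 by rewrite /l1 xd; nra.
have l12 : l1 <= l2 by rewrite /l1 /l2 xd; nra.
have [e e0 gap] := Gamma_rate_gap R kappa l1 l2 l10 l12.
have Y0 : 0 < 2 * (x + d) by lra.
pose g := e / (2 * (x + d)); have g0 : 0 < g by rewrite divr_gt0.
exists (Num.min (d ^+ 2 / 2) (x * g)).
  by rewrite lt_min (mulr_gt0 x0 g0) andbT divr_gt0// exprn_gt0.
move=> l l0; set G := Gamma_rate kappa l.
have yy0 : 0 <= v ^+ 2 + 2 * l by rewrite addr_ge0 ?sqr_ge0 ?mulr_ge0.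
pose y := Num.sqrt (v ^+ 2 + 2 * l).
have y0 : 0 <= y by exact: sqrtr_ge0.
have yE : y ^+ 2 = v ^+ 2 + 2 * l by rewrite sqr_sqrtr.
have Gy : G + v <= y.
  have := Gamma_rate_le R kappa l l0; rewrite -/v -yE -/G => h.
  rewrite (le_trans (ler_norm _))// -[leRHS]ger0_norm// -ler_sqr ?nnegrE//.
  by rewrite !real_normK ?num_real.
have -> : x * G - l = JB_rate v x - ((x - y) ^+ 2 / 2 + x * (y - (G + v))).
  have -> : l = (y ^+ 2 - v ^+ 2) / 2 by rewrite yE; field.
  by rewrite /JB_rate; field.
rewrite lerD2l lerN2 ge_min.
have xg : 0 <= x * (y - (G + v)) by rewrite mulr_ge0 ?subr_ge0// ltW.
have [yxd|yxd] := leP (d ^+ 2) ((x - y) ^+ 2); first by apply/orP; left; lra.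
apply/orP; right.
(* [y + (G + v) <= 2 * (x + d)] turns the gap between the squares of [y] and
   [G + v] into a gap between the numbers themselves *)
have /andP[ylo yhi] : (x - d < y < x + d).
  by apply/andP; split; rewrite ltNge; apply/negP => h; move: yxd; nra.
have ll1 : l1 <= l by rewrite /l1; nra.
have ll2 : l <= l2 by rewrite /l2; nra.
suff gy : g <= y - (G + v).
  have : x * g <= x * (y - (G + v)) by rewrite ler_pM2l.
  have := sqr_ge0 (x - y); lra.
have := gap l ll1 ll2; rewrite -/v -/G -yE => h.
rewrite ler_pdivrMr//.
apply: (@le_trans _ _ ((y - (G + v)) * (y + (G + v)))); first by lra.
by rewrite ler_wpM2l ?subr_ge0//; lra.
Qed.

Theorem theorem1p3 (R : realType) (kappa : R) (hkappa : 1 < kappa) :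
  let v := (kappa - 1) / 4 in
  forall x : R, v < x -> (J_rate kappa x < (JB_rate v x)%:E)%E.
Proof.
move=> v x vx; have v0 : 0 < v by rewrite /v; lra.
have x0 := lt_trans v0 vx.
have [eta eta0 gap] := Gamma_rate_legendre_gap R kappa x (ltW v0) vx.
apply: (@le_lt_trans _ _ (JB_rate v x - eta)%:E); last first.
  by rewrite lte_fin ltrBlDr ltrDl.
rewrite /J_rate -lee_pdivlMl// /I_rate -EFinM.
apply: ub_ereal_sup => _ [l /= l0 <-]; rewrite lee_fin.
rewrite -(ler_pM2l x0) mulrA divff ?gt_eqF// mul1r.
apply: le_trans (gap l l0).
by rewrite mulrBr [x * (l * _)]mulrCA divff ?gt_eqF// mulr1.
Qed.
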